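(* Consider a family of linear systems $\boldsymbol{A}\boldsymbol{u}=\boldsymbol{f}$, indexed by the grid size $h$ (and possibly by physical parameters $\boldsymbol{\mu}$), with $\boldsymbol{A}=\boldsymbol{A}_h\in\mathbb{C}^{N\times N}$ invertible and $N=N_h$. For each of them consider the hybrid iteration $$\boldsymbol{u}\leftarrow \boldsymbol{u}+\boldsymbol{B}(\boldsymbol{f}-\boldsymbol{A}\boldsymbol{u})\quad\text{(performed $M$ times starting from $\boldsymbol{u}^{(k)}$, with result $\boldsymbol{u}^{(k+1/2)}$)},$$ $$\boldsymbol{u}^{(k+1)}=\boldsymbol{u}^{(k+1/2)}+\mathcal{H}(\boldsymbol{f}-\boldsymbol{A}\boldsymbol{u}^{(k+1/2)}),$$ where $\boldsymbol{B}=\boldsymbol{B}_h$ and $\mathcal{H}=\mathcal{H}_h$ are linear maps on $\mathbb{C}^N$ and $M\ge 1$ is a fixed integer. Let $\boldsymbol{e}^{(k)}=\boldsymbol{u}-\boldsymbol{u}^{(k)}$ be the error. Let $\Theta$, $\boldsymbol{\varphi}(\boldsymbol{\theta})$ and $\tilde{E}_B(\boldsymbol{\theta})$ be the set of Fourier frequencies, the Fourier modes and the symbol of $\boldsymbol{I}-\boldsymbol{B}\boldsymbol{A}$ described in the context. Assume the following. (i) (Smoothing effect of $\boldsymbol{B}$.) $\Theta$ can be split as $\Theta=\Theta^{\boldsymbol{B}}\cup\Theta^{\mathcal{H}}$ with $$|\tilde{E}_B(\boldsymbol{\theta})|\le \mu_{\boldsymbol{B}}\ \text{ for } \boldsymbol{\theta}\in\Theta^{\boldsymbol{B}},\qquad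 \mu_{\boldsymbol{B}}<|\tilde{E}_B(\boldsymbol{\theta})|\le 1+\varepsilon_{\boldsymbol{B}}\ \text{ for }\boldsymbol{\theta}\in\Theta^{\mathcal{H}},$$ where the smoothing factor $\mu_{\boldsymbol{B}}\in(0,1)$ and the small positive constant $\varepsilon_{\boldsymbol{B}}$ are independent of $h$ and of the physical parameters $\boldsymbol{\mu}$. (ii) There exist $\epsilon>0$ and a bounded constant $\mu_{\mathcal{H}}$ (both independent of $h$) such that $$(\boldsymbol{I}-\mathcal{H}\boldsymbol{A})\boldsymbol{\varphi}(\boldsymbol{\theta})=\boldsymbol{\varphi}(\boldsymbol{\theta})\ \text{ for }\boldsymbol{\theta}\in\Theta^{\boldsymbol{B}},\qquad \|(\boldsymbol{I}-\mathcal{H}\boldsymbol{A})\boldsymbol{\varphi}(\boldsymbol{\theta})\|_2\le \frac{\mu_{\mathcal{H}}}{N^{1/2+\epsilon}}\ \text{ for }\boldsymbol{\theta}\in\Theta^{\mathcal{H}}.$$ Then for every $k\ge 0$ the error satisfies $$\|\boldsymbol{e}^{(k+1)}\|_2\le \eta\,\|\boldsymbol{e}^{(k)}\|_2,$$ with a convergence rate $\eta$ satisfying $$\eta\le\sqrt{\max\left\{2\mu_{\boldsymbol{B}}^{2M},\ \frac{C}{N^{2\epsilon}}\right\}},\qquad C=2(1+\varepsilon_{\boldsymbol{B}})^{2M}\mu_{\mathcal{H}}^2\,\frac{|\Theta^{\mathcal{H}}|}{N},$$ where $C$ is bounded (uniformly in $h$), and the rate is independent of the grid size $h$, in the sense that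 $\eta$ is bounded by a quantity that does not depend on $h$.
   Context: Grid and modes. $\boldsymbol{G}_h=\{(k_1h_1,k_2h_2):(k_1,k_2)\in\mathbb{Z}^2\}$ is the infinite grid, and the Fourier modes on it are $\varphi(\boldsymbol{\theta},\boldsymbol{x})=e^{i\theta_1x_1/h_1}e^{i\theta_2x_2/h_2}$ for $\boldsymbol{x}\in\boldsymbol{G}_h$, with frequencies $\boldsymbol{\theta}=(\theta_1,\theta_2)$ in $[-\pi,\pi)^2$. The unknowns live on a grid $\mathcal{T}_h\subset\boldsymbol{G}_h$ with $N$ points, and vectors in $\mathbb{C}^N$ are identified with functions on $\mathcal{T}_h$, extended periodically to $\boldsymbol{G}_h$. $\boldsymbol{\varphi}(\boldsymbol{\theta})\in\mathbb{C}^N$ is the restriction of $\varphi(\boldsymbol{\theta},\cdot)$ to $\mathcal{T}_h$, normalized as below. Standing assumptions. $\Theta\subset[-\pi,\pi)^2$ is the finite set of $N$ frequencies for which the (normalized) modes $\{\boldsymbol{\varphi}(\boldsymbol{\theta}):\boldsymbol{\theta}\in\Theta\}$ form an orthonormal basis of $\mathbb{C}^N$ for the inner product inducing $\|\cdot\|_2$. Thus every error expands as $\boldsymbol{e}^{(k)}=\sum_{\boldsymbol{\theta}\in\Theta}\mu^{(k)}_{\boldsymbol{\theta}}\boldsymbol{\varphi}(\boldsymbol{\theta})$ with Parseval's identity $\|\boldsymbol{e}^{(k)}\|_2^2=\sum_{\boldsymbol{\theta}\in\Theta}|\mu^{(k)}_{\boldsymbol{\theta}}|^2$. The smoothing error propagation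 operator $\boldsymbol{E}_{\boldsymbol{B}}=\boldsymbol{I}-\boldsymbol{B}\boldsymbol{A}$ is a discrete operator diagonalized by the Fourier modes: $\boldsymbol{E}_{\boldsymbol{B}}\boldsymbol{\varphi}(\boldsymbol{\theta})=\tilde{E}_B(\boldsymbol{\theta})\boldsymbol{\varphi}(\boldsymbol{\theta})$ for all $\boldsymbol{\theta}\in\Theta$, with $\tilde{E}_B(\boldsymbol{\theta})\in\mathbb{C}$ called its symbol (formal eigenvalue). $|\Theta^{\mathcal{H}}|$ denotes the cardinality of $\Theta^{\mathcal{H}}$. *)

(* Defs.v *)
From HB Require Import structures.
From mathcomp Require Import all_boot all_order all_algebra.
From mathcomp Require Import finmap.
From mathcomp Require Import complex.
From mathcomp Require Import boolp classical_sets reals exp trigo.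

Set Implicit Arguments.
Unset Strict Implicit.
Unset Printing Implicit Defensive.

Import Order.TTheory GRing.Theory Num.Theory.

Local Open Scope classical_set_scope.
Local Open Scope ring_scope.

Section EuclideanSpace.
Variables (R : realType) (N : nat).
Implicit Types u v : 'cV[R[i]]_N.

Definition cdot u v : R[i] := \sum_(j < N) u j 0 * conjc (v j 0).

(* [cdot u u] is real and nonnegative. *)
Definition l2norm u : R := Num.sqrt (complex.Re (cdot u u)).

End EuclideanSpace.

Section FourierModes.
Variable R : realType.
Implicit Types (h x theta : R * R).

Definition expi (t : R) : R[i] := Complex (cos t) (sin t).

Definition grid h : set (R * R) :=
  [set x | exists k : int * int, x = (k.1%:~R * h.1, k.2%:~R * h.2)].

Definition fourier_mode h theta x : R[i] :=
  expi (theta.1 * x.1 / h.1) * expi (theta.2 * x.2 / h.2).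

(* Entry [j] of a vector is the value of the corresponding grid function at the
   grid point [node j]. *)
Definition mode_restr h N (node : 'I_N -> R * R) theta : 'cV[R[i]]_N :=
  \col_j fourier_mode h theta (node j).

Definition mode_vec h N (node : 'I_N -> R * R) theta : 'cV[R[i]]_N :=
  ((l2norm (mode_restr h node theta))^-1)%:C%C *: mode_restr h node theta.

Definition orthonormal_basis N (I : choiceType) (S : {fset I})
    (b : I -> 'cV[R[i]]_N) : Prop :=
  (forall s t, s \in S -> t \in S -> cdot (b s) (b t) = (s == t)%:R) /\
  basis_of fullv [seq b s | s <- enum_fset S].

Definition frequency_box : set (R * R) :=
  [set theta | (- pi <= theta.1 < pi) /\ (- pi <= theta.2 < pi)].

(* [node] enumerates the [N] distinct points of the grid carrying the unknowns. *)
Definition fourier_setting h N (node : 'I_N -> R * R)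
    (Theta : {fset R * R}) : Prop :=
  [/\ (0 < N)%N /\ injective node,
      forall j, grid h (node j),
      forall theta, theta \in Theta -> frequency_box theta,
      #|` Theta|%fset = N
    & orthonormal_basis Theta (mode_vec h node)].

End FourierModes.

Section HybridIteration.
Variables (R : realType) (N : nat).
Local Notation V := ('cV[R[i]]_N).
Implicit Types (A : 'M[R[i]]_N) (B H : {linear V -> V}) (f u v : V).

Definition correct A B f u : V := u + B (f - A *m u).

Definition hybrid_step A B H (M : nat) f u : V :=
  correct A H f (iter M (correct A B f) u).

Definition hybrid_iter A B H (M : nat) f u0 (k : nat) : V :=
  iter k (hybrid_step A B H M f) u0.

(* The operator [I - B A]. *)
Definition error_op A B v : V := v - B (A *m v).

End HybridIteration.

Definition rate_const (R : realType) (epsB muH : R) (M nH N : nat) : R :=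
  2 * (1 + epsB) ^+ (2 * M) * muH ^+ 2 * (nH%:R / N%:R).

(* Main.v *)
Require Import Defs.
From HB Require Import structures.
From mathcomp Require Import all_boot all_order all_algebra.
From mathcomp Require Import finmap.
From mathcomp Require Import complex.
From mathcomp Require Import boolp classical_sets reals exp trigo.
From mathcomp Require Import ring lra.

Set Implicit Arguments.
Unset Strict Implicit.
Unset Printing Implicit Defensive.

Import Order.TTheory GRing.Theory Num.Theory.

Local Open Scope ring_scope.

(** One hybrid step acts on the error as [E_H \o E_B ^ M], where [E_B = I - B A]
    and [E_H = I - H A], because the right-hand side is [A *m u] and so each
    residual is [A] applied to the current error.  Expand the error over the
    orthonormal Fourier modes.  Since [E_B] is diagonal on them, [E_B ^ M]
    multiplies the coefficient of the mode [theta] by the [M]-th power of the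
    symbol.  Then [E_H] leaves the modes of [ThetaB] alone and nearly
    annihilates those of [ThetaH].

    The result is a sum of two vectors, and its squared norm is at most twice
    the sum of theirs: this is where the factor [2] in both branches of the
    maximum comes from.  On [ThetaB] the vector is still a combination of
    orthonormal modes, so Parseval gives the factor [muB ^+ (2 * M)].  On
    [ThetaH] the images [E_H (phi theta)] need not be orthogonal to each other,
    and Cauchy-Schwarz over the modes ([sqnorm_lincomb_le]) is used instead.
    It costs a factor [#|` ThetaH|], which the hypothesis on [E_H] absorbs: the
    square of [N ^ (1/2 + eps)] is [N * N ^ (2 eps)].  Since the two coefficient
    families share out the squared norm of the error, the larger of the two
    factors bounds the whole ([two_level_contraction]).

    Finally [ThetaH] has at most [N] elements and [N >= 1], so both [C] and
    [C / N ^ (2 eps)] are bounded by [2 (1 + epsB)^(2 M) muH^2], in which the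
    grid does not appear.  The rate [eta] is taken to be the square root of
    the maximum itself. *)

(** * Sums of squares and the Euclidean norm *)

(** Lagrange's identity: the difference of the two sides is half the double
    sum of the squares [(a s * b t - a t * b s) ^+ 2]. *)
Lemma sum_cauchy_schwarz (R : realFieldType) (I : Type) (r : seq I)
    (p : pred I) (a b : I -> R) :
  (\sum_(s <- r | p s) a s * b s) ^+ 2 <=
  (\sum_(s <- r | p s) a s ^+ 2) * (\sum_(s <- r | p s) b s ^+ 2).
Proof.
have lagrange : 0 <= \sum_(s <- r | p s) \sum_(t <- r | p t)
    (a s * b t - a t * b s) ^+ 2.
  by do 2![apply: sumr_ge0 => ? _]; exact: sqr_ge0.
suff : \sum_(s <- r | p s) \sum_(t <- r | p t) (a s * b t - a t * b s) ^+ 2 =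
    ((\sum_(s <- r | p s) a s ^+ 2) * (\sum_(s <- r | p s) b s ^+ 2) -
     (\sum_(s <- r | p s) a s * b s) ^+ 2) *+ 2.
  by move=> eq_lagrange; move: lagrange; rewrite eq_lagrange; lra.
have expand s t : (a s * b t - a t * b s) ^+ 2 =
    a s ^+ 2 * b t ^+ 2 + b s ^+ 2 * a t ^+ 2 - (a s * b s) * (a t * b t) *+ 2.
  by ring.
under eq_bigr do under eq_bigr do rewrite expand.
under eq_bigr do rewrite sumrB big_split /= sumrMnl -!mulr_sumr.
rewrite sumrB big_split /= sumrMnl -!mulr_suml.
by ring.
Qed.

Section SquaredNorm.
Variables (R : realType) (N : nat).
Implicit Types (u v : 'cV[R[i]]_N).

Definition sqnorm u : R := \sum_j Normc.normc (u j 0) ^+ 2.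

Lemma normc_ge0 (z : R[i]) : 0 <= Normc.normc z.
Proof. by case: z => a b; exact: sqrtr_ge0. Qed.

Lemma normcX (z : R[i]) n : Normc.normc (z ^+ n) = Normc.normc z ^+ n.
Proof.
elim: n => [|n IHn]; first by rewrite !expr0 Normc.normc1.
by rewrite !exprS Normc.normcM IHn.
Qed.

Lemma normc_sum (I : Type) (r : seq I) (p : pred I) (z : I -> R[i]) :
  Normc.normc (\sum_(s <- r | p s) z s) <= \sum_(s <- r | p s) Normc.normc (z s).
Proof.
elim/big_ind2: _ => [|z1 x1 z2 x2 le1 le2|//]; first by rewrite Normc.normc0.
by apply: le_trans (le_normcD _ _) _; exact: lerD.
Qed.

Lemma mulc_conjc (z : R[i]) : z * conjc z = (Normc.normc z ^+ 2)%:C%C.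
Proof. by rewrite -sqr_normc rmorphXn. Qed.

Lemma cdot_sqnorm u : cdot u u = (sqnorm u)%:C%C.
Proof. by rewrite /cdot /sqnorm rmorph_sum; apply: eq_bigr => j _; exact: mulc_conjc. Qed.

Lemma sqnorm_ge0 u : 0 <= sqnorm u.
Proof. by apply: sumr_ge0 => j _; exact: sqr_ge0. Qed.

Lemma l2normE u : l2norm u = Num.sqrt (sqnorm u).
Proof. by rewrite /l2norm cdot_sqnorm. Qed.

Lemma sqr_l2norm u : l2norm u ^+ 2 = sqnorm u.
Proof. by rewrite l2normE sqr_sqrtr ?sqnorm_ge0. Qed.

Lemma sqnormD_le u v : sqnorm (u + v) <= 2 * (sqnorm u + sqnorm v).
Proof.
rewrite /sqnorm -big_split mulr_sumr; apply: ler_sum => j _; rewrite !mxE /=.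
have := le_normcD (u j 0) (v j 0).
move: (normc_ge0 (u j 0)) (normc_ge0 (v j 0)) (normc_ge0 (u j 0 + v j 0)).
set x := Normc.normc (u j 0); set y := Normc.normc (v j 0) => x0 y0 z0 le_xy.
have : Normc.normc (u j 0 + v j 0) ^+ 2 <= (x + y) ^+ 2.
  by rewrite ler_pXn2r ?nnegrE ?addr_ge0.
by have := sqr_ge0 (x - y); nra.
Qed.

(** Cauchy-Schwarz in the index [s], applied in each entry.  It needs nothing
    about the [w s], so it covers images of modes, which are no longer
    orthogonal to each other. *)
Lemma sqnorm_lincomb_le (I : Type) (r : seq I) (p : pred I)
    (c : I -> R[i]) (w : I -> 'cV[R[i]]_N) :
  sqnorm (\sum_(s <- r | p s) c s *: w s) <=
  (\sum_(s <- r | p s) Normc.normc (c s) ^+ 2) *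
  (\sum_(s <- r | p s) sqnorm (w s)).
Proof.
rewrite {2}/sqnorm exchange_big mulr_sumr /=; apply: ler_sum => j _.
apply: le_trans (sum_cauchy_schwarz _ _ _ _).
rewrite ler_pXn2r ?nnegrE ?normc_ge0 //; last first.
  by apply: sumr_ge0 => s _; rewrite mulr_ge0 ?normc_ge0.
rewrite summxE; apply: le_trans (normc_sum _ _ _) _.
by apply: ler_sum => s _; rewrite mxE Normc.normcM.
Qed.

(** * Orthonormal bases *)

Lemma cdot_lincomb (I J : Type) (r : seq I) (q : seq J) (p : pred I)
    (p' : pred J) (c : I -> R[i]) (d : J -> R[i]) (w : I -> 'cV[R[i]]_N)
    (z : J -> 'cV[R[i]]_N) :
  cdot (\sum_(s <- r | p s) c s *: w s) (\sum_(t <- q | p' t) d t *: z t) =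
  \sum_(s <- r | p s) \sum_(t <- q | p' t) c s * conjc (d t) * cdot (w s) (z t).
Proof.
rewrite /cdot.
under [RHS]eq_bigr do under eq_bigr do rewrite mulr_sumr.
under [RHS]eq_bigr do rewrite exchange_big.
rewrite [RHS]exchange_big /=; apply: eq_bigr => j _.
rewrite !summxE rmorph_sum mulr_suml; apply: eq_bigr => s _.
rewrite mulr_sumr; apply: eq_bigr => t _.
by rewrite !mxE rmorphM /=; ring.
Qed.

Variables (I : choiceType) (S : {fset I}) (b : I -> 'cV[R[i]]_N).
Hypothesis onb : orthonormal_basis S b.

(** Parseval for a partial sum: the modes on which [I - H A] is the identity are
    only part of the basis. *)
Lemma parseval (p : pred I) (c : I -> R[i]) :
  sqnorm (\sum_(s <- S | p s) c s *: b s) =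
  \sum_(s <- S | p s) Normc.normc (c s) ^+ 2.
Proof.
apply: (@complexI R); rewrite -cdot_sqnorm cdot_lincomb rmorph_sum.
rewrite big_seq_cond [RHS]big_seq_cond; apply: eq_bigr => s /andP[sS ps].
rewrite big_mkcond (bigD1_seq s) ?fset_uniq //= ps.
have [orth _] := onb.
rewrite orth // eqxx mulr1 mulc_conjc big1_seq ?addr0 // => t /andP[t_s tS].
by case: ifP => // _; rewrite orth // eq_sym (negPf t_s) mulr0.
Qed.

Lemma orthonormal_basis_expand (e : 'cV[R[i]]_N) :
  exists c : I -> R[i], e = \sum_(s <- S) c s *: b s.
Proof.
have [_ /andP[/eqP spanb _]] := onb.
have : e \in <<[seq b s | s <- enum_fset S]>>%VS by rewrite spanb memvf.
have := fset_uniq S; rewrite /=; elim: (enum_fset S) e => [e _|s r IHr e /=].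
  by rewrite span_nil memv0 => /eqP ->; exists (fun=> 0); rewrite big_nil.
case/andP=> s_notin uniq_r; rewrite span_cons.
case/memv_addP=> _ /vlineP[k ->] [e' /(IHr _ uniq_r)[c ->] ->].
exists (fun t => if t == s then k else c t); rewrite big_cons eqxx; congr +%R.
apply: eq_big_seq => t t_r; case: eqP => // t_s.
by rewrite -t_s t_r in s_notin.
Qed.

End SquaredNorm.

(** * The two-level contraction estimate *)

Lemma iter_diagonal_lincomb (R : realType) (N : nat) (I : choiceType)
    (r : seq I) (b : I -> 'cV[R[i]]_N) (lam c : I -> R[i])
    (E : {linear 'cV[R[i]]_N -> 'cV[R[i]]_N}) (M : nat) :
  {in r, forall s, E (b s) = lam s *: b s} ->
  iter M E (\sum_(s <- r) c s *: b s) =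
  \sum_(s <- r) (c s * lam s ^+ M) *: b s.
Proof.
move=> eigE; elim: M => [|M IHM] /=.
  by apply: eq_bigr => s _; rewrite expr0 mulr1.
rewrite IHM linear_sum; apply: eq_big_seq => s s_r.
by rewrite linearZ /= eigE // scalerA exprSr mulrA.
Qed.

Lemma sum_const_fset_le (R : realDomainType) (I : choiceType)
    (S T : {fset I}) (p : pred I) (d : R) :
  0 <= d -> {in S, forall s, p s -> s \in T} ->
  \sum_(s <- S | p s) d <= d * #|` T|%:R.
Proof.
move=> d0 subT; rewrite big_const_seq iter_addr_0 -[leLHS]mulr_natr.
rewrite ler_wpM2l // ler_nat -size_filter uniq_leq_size ?filter_uniq ?fset_uniq//.
by move=> s; rewrite mem_filter => /andP[ps sS]; exact: subT.
Qed.

Section TwoLevel.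
Variables (R : realType) (N : nat) (I : choiceType).
Local Notation V := ('cV[R[i]]_N).
Variables (S SB SH : {fset I}) (b : I -> V) (lam : I -> R[i]).
Variables (EB EH : {linear V -> V}) (muB q d : R) (M : nat).

(** Every bound is on squared norms.  The sums over [S] are cut by membership in
    [SB], which makes the two parts disjoint; what lies outside [SB] is in
    [SH]. *)
Lemma two_level_contraction (e : V) :
  orthonormal_basis S b -> S = (SB `|` SH)%fset -> 0 <= d ->
  {in S, forall s, EB (b s) = lam s *: b s} ->
  {in SB, forall s, Normc.normc (lam s) <= muB} ->
  {in SH, forall s, Normc.normc (lam s) <= q} ->
  {in SB, forall s, EH (b s) = b s} ->
  {in SH, forall s, sqnorm (EH (b s)) <= d} ->
  sqnorm (EH (iter M EB e)) <=
  Num.max (2 * muB ^+ (2 * M)) (2 * q ^+ (2 * M) * (d * #|` SH|%:R)) * sqnorm e.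
Proof.
move=> onb defS d0 eigB lamB lamH fixB smallH.
have inSH : {in S, forall s, s \notin SB -> s \in SH}.
  by move=> s; rewrite defS in_fsetU => /orP[->|].
have [c ->] := orthonormal_basis_expand onb e.
rewrite parseval // (iter_diagonal_lincomb _ _ eigB) linear_sum.
under eq_bigr do rewrite linearZ /=.
rewrite (bigID (mem SB)) [X in _ <= _ * X](bigID (mem SB)) /=.
(* Restores orthonormal modes in the [SB] part, so that Parseval applies. *)
have -> : \sum_(s <- S | s \in SB) (c s * lam s ^+ M) *: EH (b s) =
    \sum_(s <- S | s \in SB) (c s * lam s ^+ M) *: b s.
  by apply: eq_bigr => s sB; rewrite fixB.
(* How much [M] smoothing sweeps shrink the coefficients of a group of modes. *)
have damp (p : pred I) (x : R) :
    {in S, forall s, p s -> Normc.normc (lam s) <= x} ->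
    \sum_(s <- S | p s) Normc.normc (c s * lam s ^+ M) ^+ 2 <=
    x ^+ (2 * M) * \sum_(s <- S | p s) Normc.normc (c s) ^+ 2.
  move=> le_x; rewrite mulr_sumr big_seq_cond [leRHS]big_seq_cond.
  apply: ler_sum => s /andP[sS ps].
  rewrite Normc.normcM normcX exprMn mulrC -exprM mulnC.
  rewrite ler_wpM2r ?sqr_ge0 // lerXn2r ?nnegrE ?normc_ge0 ?le_x //.
  by apply: le_trans (le_x s sS ps); exact: normc_ge0.
apply: le_trans (sqnormD_le _ _) _; rewrite parseval //.
set XB := \sum_(s <- S | s \in SB) Normc.normc (c s) ^+ 2.
set XH := \sum_(s <- S | s \notin SB) Normc.normc (c s) ^+ 2.
have XB0 : 0 <= XB by apply: sumr_ge0 => s _; exact: sqr_ge0.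
have XH0 : 0 <= XH by apply: sumr_ge0 => s _; exact: sqr_ge0.
have boundB : \sum_(s <- S | s \in SB) Normc.normc (c s * lam s ^+ M) ^+ 2 <=
    muB ^+ (2 * M) * XB.
  by apply: (damp (mem SB)) => s _ /lamB.
have boundH : sqnorm (\sum_(s <- S | s \notin SB) (c s * lam s ^+ M) *: EH (b s))
    <= q ^+ (2 * M) * XH * (d * #|` SH|%:R).
  apply: le_trans (sqnorm_lincomb_le _ _ _ _) _; apply: ler_pM.
  - by apply: sumr_ge0 => s _; exact: sqr_ge0.
  - by apply: sumr_ge0 => s _; exact: sqnorm_ge0.
  - by apply: (damp (fun s => s \notin SB)) => s sS sB; exact/lamH/inSH.
  - apply: le_trans (sum_const_fset_le d0 inSH).
    rewrite big_seq_cond [leRHS]big_seq_cond.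
    by apply: ler_sum => s /andP[sS sB]; exact/smallH/inSH.
set x := 2 * muB ^+ _; set y := 2 * q ^+ _ * _.
have lex : x * XB <= Num.max x y * XB by rewrite ler_wpM2r // le_max lexx.
have ley : y * XH <= Num.max x y * XH by rewrite ler_wpM2r // le_max lexx orbT.
by rewrite [leRHS]mulrDr; apply: le_trans (lerD lex ley); rewrite /x /y; lra.
Qed.

End TwoLevel.

(** * Error propagation of the hybrid iteration *)

Section ErrorPropagation.
Variables (R : realType) (N : nat).
Local Notation V := ('cV[R[i]]_N).
Implicit Types (A : 'M[R[i]]_N) (B H : {linear V -> V}) (f u v : V).

Lemma error_op_is_linear A B : linear (error_op A B).
Proof.
move=> k v w; rewrite /error_op mulmxDr -scalemxAr linearD linearZ /=.
by rewrite scalerBr opprD addrACA.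
Qed.

HB.instance Definition _ A B :=
  GRing.isLinear.Build _ V V _ (error_op A B) (error_op_is_linear A B).

(** Consistency: with the right-hand side [A *m u], the residual at [v] is [A]
    applied to the error, so [u] is a fixed point and the affine iteration
    becomes linear in [u - v]. *)
Lemma correct_error A B u v :
  u - correct A B (A *m u) v = error_op A B (u - v).
Proof. by rewrite /correct /error_op -mulmxBr opprD addrA. Qed.

Lemma iter_correct_error A B u v M :
  u - iter M (correct A B (A *m u)) v = iter M (error_op A B) (u - v).
Proof. by elim: M => [|M IHM] //=; rewrite correct_error IHM. Qed.

Lemma hybrid_step_error A B H M u v :
  u - hybrid_step A B H M (A *m u) v =
  error_op A H (iter M (error_op A B) (u - v)).
Proof. by rewrite /hybrid_step correct_error iter_correct_error. Qed.

End ErrorPropagation.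

(** * The convergence rate *)

Section Rate.
Variable R : realType.

(** The exponent [1/2] pays for the factor [N] that Cauchy-Schwarz over the
    [nH <= N] poorly smoothed modes can cost; [eps] is what is left as decay in [N]. *)
Lemma rate_constE (epsB muH eps : R) (M nH N : nat) : (0 < N)%N ->
  2 * (1 + epsB) ^+ (2 * M) * ((muH / N%:R `^ (2^-1 + eps)) ^+ 2 * nH%:R) =
  rate_const epsB muH M nH N / N%:R `^ (2 * eps).
Proof.
move=> N0; have NR : 0 < N%:R :> R by rewrite ltr0n.
have -> : (muH / N%:R `^ (2^-1 + eps)) ^+ 2 =
    muH ^+ 2 / (N%:R * N%:R `^ (2 * eps)).
  rewrite expr_div_n -[in LHS](@powR_mulrn _ (_ `^ _) 2) ?powR_ge0 //.
  rewrite -powRrM mulrDl mulVf ?pnatr_eq0 // [eps * _]mulrC.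
  by rewrite powRD ?powRr1 ?ltW // (gt_eqF NR) implybT.
rewrite /rate_const invfM; ring.
Qed.

Lemma rate_const_bounds (epsB muH : R) (M nH N : nat) : 0 <= epsB ->
  (0 < N)%N -> (nH <= N)%N ->
  0 <= rate_const epsB muH M nH N <= 2 * (1 + epsB) ^+ (2 * M) * muH ^+ 2.
Proof.
move=> eps0 N0 le_nH; have NR : 0 < N%:R :> R by rewrite ltr0n.
have coef0 : 0 <= 2 * (1 + epsB) ^+ (2 * M) * muH ^+ 2.
  by apply: mulr_ge0 (sqr_ge0 _); apply/mulr_ge0/exprn_ge0/addr_ge0.
rewrite /rate_const mulr_ge0 ?divr_ge0 //=.
by rewrite ler_piMr // ler_pdivrMr // mul1r ler_nat.
Qed.

End Rate.

Theorem theorem1 (R : realType)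
  (Hs : set (R * R)) (P : Type)
  (hpos : forall h, Hs h -> 0 < h.1 /\ 0 < h.2)
  (N : R * R -> nat)
  (node : forall h, 'I_(N h) -> R * R)
  (Theta : R * R -> {fset (R * R)})
  (hTheta : forall h, Hs h -> fourier_setting h (node h) (Theta h))
  (A : forall h, P -> 'M[R[i]]_(N h))
  (hA : forall h p, Hs h -> A h p \in unitmx)
  (B : forall h, P -> {linear 'cV[R[i]]_(N h) -> 'cV[R[i]]_(N h)})
  (H : forall h, P -> {linear 'cV[R[i]]_(N h) -> 'cV[R[i]]_(N h)})
  (M : nat) (hM : (1 <= M)%N)
  (EB : R * R -> P -> R * R -> R[i])
  (hEB : forall h p theta, Hs h -> theta \in Theta h ->
     error_op (A h p) (B h p) (mode_vec h (node h) theta)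
       = EB h p theta *: mode_vec h (node h) theta)
  (ThetaB ThetaH : R * R -> P -> {fset (R * R)})
  (muB epsB : R) (hmuB : 0 < muB < 1) (hepsB : 0 < epsB)
  (hsplit : forall h p, Hs h -> Theta h = (ThetaB h p `|` ThetaH h p)%fset)
  (hsmoothB : forall h p theta, Hs h -> theta \in ThetaB h p ->
     Normc.normc (EB h p theta) <= muB)
  (hsmoothH : forall h p theta, Hs h -> theta \in ThetaH h p ->
     muB < Normc.normc (EB h p theta) <= 1 + epsB)
  (eps muH : P -> R) (heps : forall p, 0 < eps p)
  (hHB : forall h p theta, Hs h -> theta \in ThetaB h p ->
     error_op (A h p) (H h p) (mode_vec h (node h) theta)
       = mode_vec h (node h) theta)
  (hHH : forall h p theta, Hs h -> theta \in ThetaH h p ->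
     l2norm (error_op (A h p) (H h p) (mode_vec h (node h) theta))
       <= muH p / (N h)%:R `^ (2^-1 + eps p)) :
  let C h p := rate_const epsB (muH p) M #|` ThetaH h p|%fset (N h) in
  exists eta : R * R -> P -> R,
    [/\ forall h p, Hs h ->
          forall f u u0 : 'cV[R[i]]_(N h), A h p *m u = f -> forall k : nat,
          let e j := u - hybrid_iter (A h p) (B h p) (H h p) M f u0 j in
          l2norm (e k.+1) <= eta h p * l2norm (e k),
        forall h p, Hs h ->
          eta h p <= Num.sqrt (Num.max (2 * muB ^+ (2 * M))
                                       (C h p / (N h)%:R `^ (2 * eps p))),
        forall p, exists Cbar : R, forall h, Hs h -> `|C h p| <= Cbar
      & forall p, exists etabar : R, forall h, Hs h -> eta h p <= etabar].
Proof.
move=> C.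
pose eta h p := Num.sqrt (Num.max (2 * muB ^+ (2 * M))
                                  (C h p / (N h)%:R `^ (2 * eps p))).
have [muB0 _] := andP hmuB.
have N_gt0 h : Hs h -> (0 < N h)%N by case/hTheta => -[].
have C_bounds h p : Hs h ->
    0 <= C h p <= 2 * (1 + epsB) ^+ (2 * M) * muH p ^+ 2.
  move=> hh; apply: rate_const_bounds (ltW hepsB) (N_gt0 _ hh) _.
  have [_ _ _ cardTheta _] := hTheta _ hh; rewrite -cardTheta.
  by apply: fsubset_leq_card; rewrite (hsplit _ p hh) fsubsetUr.
exists eta; split=> [h p hh f u u0 <- k|h p hh|p|p].
- have [_ _ _ _ onb] := hTheta _ hh.
  lazy zeta; rewrite /hybrid_iter iterS hybrid_step_error.
  rewrite /eta /C !l2normE -rate_constE ?N_gt0 // -sqrtrM; last first.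
    by rewrite le_max mulr_ge0 // exprn_ge0 // ltW.
  apply: ler_wsqrtr; apply: two_level_contraction onb (hsplit _ p hh) _ _ _ _ _ _.
  + exact: sqr_ge0.
  + by move=> s sT; exact: hEB.
  + by move=> s sB; exact: hsmoothB.
  + by move=> s sH; have /andP[] := hsmoothH _ p _ hh sH.
  + by move=> s sB; exact: hHB.
  + move=> s sH; rewrite -sqr_l2norm; have le_s := hHH _ p _ hh sH.
    have l0 : 0 <= l2norm (error_op (A h p) (H h p) (mode_vec h (@node h) s)).
      exact: sqrtr_ge0.
    by rewrite lerXn2r ?nnegrE //; exact: le_trans le_s.
- exact: lexx.
- exists (2 * (1 + epsB) ^+ (2 * M) * muH p ^+ 2) => h hh.
  by have /andP[C0 leC] := C_bounds h p hh; rewrite ger0_norm.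
- exists (Num.sqrt (Num.max (2 * muB ^+ (2 * M))
                            (2 * (1 + epsB) ^+ (2 * M) * muH p ^+ 2))) => h hh.
  have /andP[C0 leC] := C_bounds h p hh.
  apply: ler_wsqrtr; rewrite ge_max le_max lexx /= le_max; apply/orP; right.
  have N_eps : 1 <= (N h)%:R `^ (2 * eps p).
    rewrite -[leLHS](powRr0 (N h)%:R); apply: ler_powR; first by rewrite ler1n N_gt0.
    by rewrite mulr_ge0 // ltW.
  apply: le_trans leC; rewrite ler_pdivrMr ?(lt_le_trans ltr01) //.
  by rewrite ler_peMr.
Qed.
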